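(* Let $\nu$ be a compactly supported finite Borel measure on $\mathbb{R}_+$ such that $\nu(\{1\})=0$, let $c\in\mathbb{R}_+$, and define $$\gamma_n(t)=1+tn+cn^2+\int_{\mathbb{R}_+}Q_n\,d\nu,\quad t\in\mathbb{R},\ n\in\mathbb{Z}_+.$$ Let $\vartheta$, $\varGamma_1$, $\varGamma_2$, $\varOmega$ and $\mathfrak{b}$ be as defined in the context. Then: (i) $\varOmega=(\mathfrak{b},\infty)$ with $-\infty<\mathfrak{b}<0$ if any of the following conditions holds: (i-a) $\vartheta>1$, (i-b) $\vartheta\leq1$ and $c>0$, (i-c) $\vartheta\leq1$, $c=0$ and $\varGamma_1=\infty$; (ii) if $\vartheta\leq1$, $c=0$ and $\varGamma_1<\infty$, then (ii-a) $\varOmega=(\mathfrak{b},\infty)$ with $-\varGamma_1<\mathfrak{b}<0$ if $1<\varGamma_2\leq\infty$, (ii-b) $\varOmega=(-\varGamma_1,\infty)$ if $\varGamma_2=1$ and $\nu=\delta_0$, (ii-c) $\varOmega=[-\varGamma_1,\infty)$ if $\varGamma_2=1$ and $\nu\neq\delta_0$, (ii-d) $\varOmega=[-\varGamma_1,\infty)$ if $\varGamma_2<1$.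
   Context: $\mathbb{Z}_+=\{0,1,2,\dots\}$, $\mathbb{R}_+=[0,\infty)$; all measures are positive; $\delta_0$ is the Borel probability measure concentrated at $0$. The polynomials $Q_n$ are $Q_0=Q_1=0$ and $Q_n(x)=\sum_{j=0}^{n-2}(n-j-1)x^j$ for $n\geq 2$. Notation: $\vartheta:=\sup\mathrm{supp}(\nu)$ (closed support, with $\sup\emptyset=-\infty$); $\varGamma_j:=\int_{\mathbb{R}_+}\frac{1}{(1-x)^j}\,d\nu(x)$ for $j=1,2$ whenever the integrals make sense (values in $[0,\infty]$ when $\vartheta\leq 1$; note $\nu(\{1\})=0$); $\varOmega:=\{t\in\mathbb{R}\colon \gamma_n(t)>0\text{ for all }n\in\mathbb{Z}_+\}$; $\mathfrak{b}:=\inf\varOmega$ (which is a real number). *)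

(* Defs.v *)
From HB Require Import structures.
From mathcomp Require Import all_boot all_order all_algebra.
From mathcomp Require Import all_classical all_reals all_analysis.
Set Implicit Arguments.
Unset Strict Implicit.
Unset Printing Implicit Defensive.
Import Order.TTheory GRing.Theory Num.Theory.
Import numFieldNormedType.Exports.
Local Open Scope classical_set_scope.
Local Open Scope ring_scope.

Definition Rplus {R : realType} : set R := `[0, +oo[%classic.

(* A Borel measure on [0, +oo[ is represented by a Borel measure on R for
   which the complement of [0, +oo[ is null. *)
Definition on_Rplus (R : realType) (nu : {measure set R -> \bar R}) : Prop :=
  nu (~` Rplus) = 0%E.

(* The closed support: the complement of the union of the open null sets. *)
Definition msupp (R : realType) (nu : {measure set R -> \bar R}) : set R :=
  [set x | forall U : set R, open U -> U x -> (0 < nu U)%E].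

Definition compactly_supported (R : realType)
    (nu : {measure set R -> \bar R}) : Prop :=
  compact (msupp nu).

(* Library measures are functions on all subsets, constrained only on the
   measurable ones, so nu = \d_0 is an equality on the Borel sets. *)
Definition is_dirac0 (R : realType) (nu : {measure set R -> \bar R}) : Prop :=
  forall A : set R, measurable A -> nu A = \d_(0 : R) A.

(* The sum is empty for n = 0 and n = 1. *)
Definition Q (R : realType) (n : nat) : {poly R} :=
  \sum_(0 <= j < n.-1) (n - j - 1)%:R *: 'X^j.

(* sup of the support in \bar R; it is -oo when the support is empty. *)
Definition vartheta (R : realType) (nu : {measure set R -> \bar R}) : \bar R :=
  ereal_sup [set x%:E | x in msupp nu].

(* The integrand has the junk value 0 at x = 1, a point which is assumed to be
   nu-null; the integral is only meaningful in general if vartheta nu <= 1. *)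
Definition Gamma_ (R : realType) (nu : {measure set R -> \bar R}) (j : nat) :
    \bar R :=
  (\int[nu]_(x in Rplus) (1 / (1 - x) ^+ j)%:E)%E.

Definition gamma_ (R : realType) (nu : {measure set R -> \bar R}) (c : R)
    (n : nat) (t : R) : R :=
  1 + t * n%:R + c * n%:R ^+ 2 + \int[nu]_(x in Rplus) (Q R n).[x].

Definition Omega (R : realType) (nu : {measure set R -> \bar R}) (c : R) :
    set R :=
  [set t | forall n : nat, 0 < gamma_ nu c n t].

(* The infimum is taken in \bar R, so that its finiteness is a genuine
   assertion. *)
Definition frakb (R : realType) (nu : {measure set R -> \bar R}) (c : R) :
    \bar R :=
  ereal_inf [set t%:E | t in Omega nu c].

(* Main.v *)
Require Import Defs.
From HB Require Import structures.
From mathcomp Require Import all_boot all_order all_algebra.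
From mathcomp Require Import all_classical all_reals all_analysis.
From mathcomp Require Import measurable_realfun ring lra.
Set Implicit Arguments.
Unset Strict Implicit.
Unset Printing Implicit Defensive.
Import Order.TTheory GRing.Theory Num.Theory.
Import numFieldNormedType.Exports.
Local Open Scope classical_set_scope.
Local Open Scope ring_scope.

(** Write S_n = 1 + x + ... + x^(n-1), so that Q_n = S_0 + ... + S_(n-1). For
n >= 1 the value gamma_n(t) is n (t + m_n), where the slope m_n =
(1 + c n^2 + \int Q_n) / n is positive and does not depend on t, while
gamma_0 = 1. Hence Omega is the intersection of the open rays ]-m_n, oo[, and
everything depends on whether the infimum of the m_n is attained. If it is,
Omega is an open ray with a negative end point ([Omega_open_ray]); it is
attained as soon as some m_(n0) is eventually a lower bound of the sequence.

The growth of m_n comes from Q_n >= (n - K) S_K on the half-line: every real A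
below some \int S_K is eventually below m_n ([slope_eventually_ge]). If
vartheta > 1, then \int S_K >= K nu(]1, oo[) is unbounded in K. If
vartheta <= 1, then nu lives on [0, 1[, where S_K increases to 1 / (1 - x), so
that \int S_K increases to Gamma_1 by monotone convergence. Together with the
term c n this shows that m_n tends to infinity in the three cases of (i).

If c = 0 and Gamma_1 is finite, integrating the identity
n / (1 - x) = Q_n + S_n / (1 - x) gives m_n = Gamma_1 + (1 - D_n) / n with
D_n = \int S_n / (1 - x) ([slope_deficit]), and D_n increases to Gamma_2. If
Gamma_2 > 1, some D_n exceeds 1, so some m_n lies below Gamma_1, hence
eventually below the sequence, and the infimum is attained. If D_n < 1 for all
n >= 1, which is the case when Gamma_2 < 1, then Gamma_1 < m_n <= Gamma_1 + 1/n
and Omega is the closed ray from -Gamma_1 ([Omega_closed_ray]). Finally, when Gamma_2 = 1, the equality D_n = 1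
means \int x^n / (1 - x)^2 = 0, which forces nu to be carried by 0 and to have
mass 1 there ([deficit1_dirac0]); conversely D_n = 1 for all n >= 1 when
nu = delta_0. *)

Local Notation I01 := (`[0%R, 1%R[%classic).

(** * Geometric sums and the polynomials Q_n *)

Definition geom (R : realType) (n : nat) : {poly R} := \sum_(k < n) 'X^k.

Lemma horner_geom (R : realType) n (x : R) :
  (geom R n).[x] = \sum_(k < n) x ^+ k.
Proof. by rewrite horner_sum; apply: eq_bigr => i _; rewrite hornerXn. Qed.

(** This is what makes the integrals of Q_n grow: each increment
\int Q_(n+1) - \int Q_n is \int S_n. *)
Lemma Q_geom (R : realType) n : Q R n = \sum_(k < n) geom R k.
Proof.
have QE m : Q R m = \sum_(j < m) (m - j - 1)%:R *: 'X^j.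
  rewrite /Q big_mkord; case: m => [|m]; first by rewrite !big_ord0.
  by rewrite [RHS]big_ord_recr /= subSnn scale0r addr0.
elim: n => [|n IHn]; first by rewrite QE !big_ord0.
rewrite [RHS]big_ord_recr /= -IHn !QE /geom -big_split /= big_ord_recr /=.
rewrite subSnn scale0r addr0; apply: eq_bigr => j _.
have -> : (n.+1 - j - 1 = (n - j - 1).+1)%N.
  by rewrite subSn 1?ltnW// !subn1 /= prednK// subn_gt0.
by rewrite -natr1 scalerDl scale1r.
Qed.

Lemma horner_Q (R : realType) n (x : R) :
  (Q R n).[x] = \sum_(k < n) (geom R k).[x].
Proof. by rewrite Q_geom horner_sum. Qed.

Lemma geom_ge0 (R : realType) n (x : R) : 0 <= x -> 0 <= (geom R n).[x].
Proof.
by move=> x0; rewrite horner_geom sumr_ge0// => k _; rewrite exprn_ge0.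
Qed.

Lemma Q_ge0 (R : realType) n (x : R) : 0 <= x -> 0 <= (Q R n).[x].
Proof. by move=> x0; rewrite horner_Q sumr_ge0// => k _; exact: geom_ge0. Qed.

Lemma geom_nondecreasing (R : realType) (x : R) : 0 <= x ->
  nondecreasing_seq (fun n => (geom R n).[x]).
Proof.
move=> x0; apply/nondecreasing_seqP => n.
by rewrite !horner_geom big_ord_recr /= lerDl exprn_ge0.
Qed.

Lemma geom_ge1 (R : realType) n (x : R) : 1 <= x -> n%:R <= (geom R n).[x].
Proof.
move=> x1; rewrite horner_geom -[in n%:R](card_ord n) -sumr_const.
by apply: ler_sum => k _; rewrite exprn_ege1.
Qed.

(** All but the first m of the n summands of Q_n are at least S_m. *)
Lemma geom_Q_le (R : realType) m n (x : R) : 0 <= x ->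
  (n%:R - m%:R) * (geom R m).[x] <= (Q R n).[x].
Proof.
move=> x0; have [nm|mn] := leqP n m.
  apply: (@le_trans _ _ 0); last exact: Q_ge0.
  by rewrite mulr_le0_ge0 ?geom_ge0// subr_le0 ler_nat.
rewrite -natrB 1?ltnW// mulr_natl -[in leLHS](card_ord (n - m)) -sumr_const.
rewrite horner_Q -[in leRHS](subnKC (ltnW mn)) big_split_ord /= -[leLHS]add0r.
apply: lerD; first by apply: sumr_ge0 => k _; exact: geom_ge0.
by apply: ler_sum => k _; apply: geom_nondecreasing => //; exact: leq_addr.
Qed.

Lemma geomE (R : realType) n (x : R) :
  (1 - x) * (geom R n).[x] = 1 - x ^+ n.
Proof.
rewrite -[in RHS](expr1n _ n) subrXX horner_geom; congr *%R.
by apply: eq_bigr => i _; rewrite expr1n mul1r.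
Qed.

(** Each summand of (1 - x) Q_n is 1 - x^k, and the powers add up to S_n. *)
Lemma Q_geomE (R : realType) n (x : R) :
  (1 - x) * (Q R n).[x] + (geom R n).[x] = n%:R.
Proof.
rewrite horner_Q mulr_sumr.
under eq_bigr do rewrite geomE.
by rewrite sumrB sumr_const card_ord horner_geom subrK.
Qed.

(** * Support, integrability and measurability *)

(** Each point of U has a null neighbourhood, which can be taken to be a ball
with rational centre and radius; there are countably many of those. *)
Lemma measure_disjoint_msupp (R : realType) (nu : {measure set R -> \bar R})
    (U : set R) :
  open U -> U `&` msupp nu = set0 -> nu U = 0%E.
Proof.
move=> oU U0; pose B (cr : rat * rat) : set R := ball (@ratr R cr.1) (ratr cr.2).
(* the null rational balls, enumerated through the codes of their parameters *)
pose F k := if unpickle k is Some cr then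
  (if nu (B cr) == 0%E then B cr else set0) else set0.
have mB cr : measurable (B cr) by apply: open_measurable; exact: ball_open.
have F0 k : nu.-negligible (F k).
  rewrite /F; case: unpickle => [cr|]; last exact: negligible_set0.
  by case: eqP => [B0|_]; [exact/negligibleP|exact: negligible_set0].
apply: measure_negligible; first exact: open_measurable.
apply: negligibleS (negligible_bigcup F0) => x Ux.
have [V [oV Vx V0]] : exists V, [/\ open V, V x & nu V = 0%E].
  apply: contrapT => noV; suff : (U `&` msupp nu) x by rewrite U0.
  split=> // V oV Vx; rewrite lt0e measure_ge0 andbT; apply/eqP => V0.
  by apply: noV; exists V.
have [c [r [/set_mem xB BV]]] := open_subball_rat oV (mem_set Vx).
have B0 : nu (B (c, r)) == 0%E.
  by rewrite -measure_le0 -V0 le_measure ?inE//; exact: open_measurable.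
have [k Fk] : exists k, F k = B (c, r).
  by exists (pickle (c, r)); rewrite /F pickleK B0.
by exists k => //; rewrite Fk.
Qed.

Lemma measure_gt_sup_msupp (R : realType) (nu : {measure set R -> \bar R})
    (a : R) : (vartheta nu <= a%:E)%E -> nu `]a, +oo[%classic = 0%E.
Proof.
move=> sa; apply: measure_disjoint_msupp; first exact: interval_open.
apply/seteqP; split=> // x [/=]; rewrite in_itv/= andbT => ax sx.
suff : (x%:E <= a%:E)%E by rewrite lee_fin leNgt ax.
by apply: le_trans sa; apply: ereal_sup_ubound; exists x.
Qed.

Lemma measure_lt_sup_msupp (R : realType) (nu : {measure set R -> \bar R})
    (a : R) : (a%:E < vartheta nu)%E -> (0 < nu `]a, +oo[%classic)%E.
Proof.
move=> /ereal_sup_gt[_ [x sx <-]]; rewrite lte_fin => ax.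
by apply: sx; [exact: interval_open|rewrite /= in_itv/= ax].
Qed.

Lemma compactly_supported_tail (R : realType)
    (nu : {measure set R -> \bar R}) :
  compactly_supported nu -> exists M : R, nu `]M, +oo[%classic = 0%E.
Proof.
move=> /compact_bounded[M [_ bM]]; exists (`|M| + 1).
apply: measure_gt_sup_msupp; apply: ge_ereal_sup => _ [x sx <-].
rewrite lee_fin; apply: le_trans (ler_norm x) _; apply: bM => //.
by rewrite (le_lt_trans (ler_norm M))// ltrDl.
Qed.

Lemma measurable_Rplus (R : realType) : measurable (@Rplus R).
Proof. exact: measurable_itv. Qed.

Lemma integrable_horner (R : realType) (nu : {finite_measure set R -> \bar R})
    (p : {poly R}) : compactly_supported nu ->
  nu.-integrable Rplus (EFin \o horner p).
Proof.
move=> /compactly_supported_tail[M nuM].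
apply/(@negligible_integrable _ _ _ nu _ `]M, +oo[%classic) => //.
- exact: measurable_Rplus.
- by apply/measurable_EFinP; exact: measurable_poly.
apply: measurable_bounded_integrable.
- by apply: measurableD => //; exact: measurable_Rplus.
- by rewrite ltey_eq fin_num_measure//; apply: measurableD => //;
    exact: measurable_Rplus.
- exact: measurable_poly.
have /compact_bounded : compact (horner p @` `[0, M]).
  apply: continuous_compact; last exact: segment_compact.
  exact/continuous_subspaceT/continuous_horner.
move=> [K [Kr bK]]; exists K; split=> // y Ky x [].
rewrite /Rplus/= !in_itv/= !andbT => x0 /negP; rewrite -leNgt => xM.
by apply: (bK y Ky); exists x => //=; rewrite in_itv/= x0.
Qed.

(** Inversion is continuous away from 0, and a single point does not matter for
measurability. *)
Lemma measurable_inv (R : realType) : measurable_fun setT (@GRing.inv R).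
Proof.
rewrite -(setUv [set (0 : R)]); apply/measurable_funU => //.
  exact: measurableC.
split; first exact: measurable_fun_set1.
apply: open_continuous_measurable_fun.
  exact: closed_openC.
move=> x /set_mem /= /eqP x0; exact: inv_continuous.
Qed.

Lemma measurable_onemV (R : realType) (D : set R) :
  measurable_fun D (fun x : R => (1 - x)^-1).
Proof.
apply: measurable_funTS; apply: (measurableT_comp (@measurable_inv R)).
exact: measurable_funB.
Qed.

(** * The set Omega as an intersection of rays *)

(** For n >= 1, the opposite of the zero of the affine function
[gamma_ nu c n]. *)
Definition slope (R : realType) (nu : {measure set R -> \bar R}) (c : R)
    (n : nat) : R :=
  (1 + c * n%:R ^+ 2 + \int[nu]_(x in Rplus) (Q R n).[x]) / n%:R.

Lemma Rplus_ge0 (R : realType) (x : R) : Rplus x -> 0 <= x.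
Proof. by rewrite /Rplus/= in_itv/= andbT. Qed.

Lemma Rintegral_Q_ge0 (R : realType) (nu : {measure set R -> \bar R}) n :
  0 <= \int[nu]_(x in Rplus) (Q R n).[x].
Proof. by apply: Rintegral_ge0 => x /Rplus_ge0; exact: Q_ge0. Qed.

Lemma slope_gt0 (R : realType) (nu : {measure set R -> \bar R}) c n :
  0 <= c -> (0 < n)%N -> 0 < slope nu c n.
Proof.
move=> c0 n0; rewrite divr_gt0 ?ltr0n// -addrA ltr_pwDl//.
by rewrite addr_ge0 ?Rintegral_Q_ge0// mulr_ge0// exprn_ge0.
Qed.

Lemma gamma_0_eq1 (R : realType) (nu : {measure set R -> \bar R}) c t :
  gamma_ nu c 0 t = 1.
Proof.
rewrite /gamma_ mulr0 expr0n mulr0 !addr0 Q_geom big_ord0.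
under eq_Rintegral do rewrite horner0.
by rewrite /Rintegral integral0 addr0.
Qed.

Lemma gamma_gt0E (R : realType) (nu : {measure set R -> \bar R}) c n t :
  (0 < n)%N -> (0 < gamma_ nu c n t) = (- slope nu c n < t).
Proof.
move=> n0; have n0' : (0 : R) < n%:R by rewrite ltr0n.
rewrite ltrNl ltr_pdivlMr// /gamma_ -[in RHS]subr_gt0; congr (_ < _).
by ring.
Qed.

Lemma OmegaP (R : realType) (nu : {measure set R -> \bar R}) c t :
  Omega nu c t <-> forall n, (0 < n)%N -> - slope nu c n < t.
Proof.
split=> [Ot n n0|Ot [|n]]; first by rewrite -gamma_gt0E.
  by rewrite gamma_0_eq1.
by rewrite gamma_gt0E// Ot.
Qed.

Lemma ereal_inf_ray (R : realType) (b : R) :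
  ereal_inf [set t%:E | t in [set t | b < t]] = b%:E.
Proof.
apply/eqP; rewrite eq_le; apply/andP; split.
  apply/lee_addgt0Pr => e e0; apply: ereal_inf_lbound; exists (b + e) => //=.
  by rewrite ltrDl.
by apply: le_ereal_inf_tmp => _ [t /= bt <-]; rewrite lee_fin ltW.
Qed.

(** Only the indices up to n0 + N compete for the minimum. *)
Lemma slope_attains_min (R : realType) (nu : {measure set R -> \bar R}) c n0 :
  (0 < n0)%N -> (exists N, forall n, (N <= n)%N -> slope nu c n0 <= slope nu c n) ->
  exists n1, [/\ (0 < n1)%N, slope nu c n1 <= slope nu c n0 &
    forall n, (0 < n)%N -> slope nu c n1 <= slope nu c n].
Proof.
move=> n0_gt0 [N hN]; have i0P : (n0.-1 < n0 + N)%N by rewrite ltn_addr// prednK.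
have [i _ hi] := arg_minP (fun i : 'I_(n0 + N) => slope nu c i.+1)
  (erefl true : xpredT (Ordinal i0P)).
have i_n0 : slope nu c i.+1 <= slope nu c n0.
  by have := hi (Ordinal i0P) isT; rewrite /= prednK.
exists i.+1; split=> // n n_gt0; have [nM|Mn] := leqP n (n0 + N).
  have nP : (n.-1 < n0 + N)%N by rewrite prednK.
  by have := hi (Ordinal nP) isT; rewrite /= prednK.
by apply: le_trans i_n0 _; apply: hN; rewrite (leq_trans _ (ltnW Mn))// leq_addl.
Qed.

Lemma Omega_open_ray (R : realType) (nu : {measure set R -> \bar R}) c n0 :
  0 <= c -> (0 < n0)%N ->
  (exists N, forall n, (N <= n)%N -> slope nu c n0 <= slope nu c n) ->
  [/\ Omega nu c = [set t | (frakb nu c < t%:E)%E],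
      (-oo < frakb nu c < 0)%E & ((- slope nu c n0)%:E <= frakb nu c)%E].
Proof.
move=> c0 n0_gt0 /(slope_attains_min n0_gt0)[n1 [n1_gt0 n10 n1min]].
have OE : Omega nu c = [set t | - slope nu c n1 < t].
  apply/seteqP; split=> t /=; first by move/OmegaP; exact.
  by move=> h; apply/OmegaP => n /n1min; rewrite -lerN2 => /le_lt_trans; exact.
have bE : frakb nu c = (- slope nu c n1)%:E by rewrite /frakb OE ereal_inf_ray.
rewrite bE lee_fin lerN2 n10 ltNyr lte_fin oppr_lt0 slope_gt0//.
Qed.

Lemma Omega_closed_ray (R : realType) (nu : {measure set R -> \bar R}) c g :
  (forall n, (0 < n)%N -> g < slope nu c n <= g + n%:R^-1) ->
  Omega nu c = [set t | - g <= t].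
Proof.
move=> gs; apply/seteqP; split=> t /=.
  move=> /OmegaP Ot; rewrite leNgt; apply/negP => /ltr_add_invr[n tn].
  have /andP[_ sn] := gs n.+1 isT; have tsn := Ot n.+1 isT.
  move: (slope _ _ _) (n.+1%:R^-1) tn sn tsn => a b ? ? ?; lra.
by move=> gt; apply/OmegaP => n /gs/andP[? _]; lra.
Qed.

(** * Growth of the slopes *)

(** Since \int Q_n >= (n - K) \int S_K, the limit inferior of the slopes is at
least \int S_K. *)
Lemma slope_eventually_ge (R : realType) (nu : {finite_measure set R -> \bar R})
    c A K : compactly_supported nu -> 0 <= c ->
  A < \int[nu]_(x in Rplus) (geom R K).[x] ->
  exists N, forall n, (N <= n)%N -> A <= slope nu c n.
Proof.
move=> cpt c0; set s := \int[nu]_(x in _) _ => As.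
have s0 : 0 <= s by apply: Rintegral_ge0 => x /Rplus_ge0; exact: geom_ge0.
(* solves (n - K) s >= A n for n *)
exists (Num.truncn (K%:R * s / (s - A))).+1 => n Nn.
have n0 : (0 < n)%N by exact: leq_trans Nn.
rewrite ler_pdivlMr ?ltr0n//.
have qn : (n%:R - K%:R) * s <= \int[nu]_(x in Rplus) (Q R n).[x].
  rewrite -RintegralZl; [|exact: measurable_Rplus|exact: integrable_horner].
  apply: le_Rintegral => /=.
  - exact: measurable_Rplus.
  - apply: (eq_integrable _ (EFin \o horner ((n%:R - K%:R) *: geom R K))).
    + exact: measurable_Rplus.
    + by move=> x _ /=; rewrite hornerZ.
    + exact: integrable_horner.
  - exact: integrable_horner.
  - by move=> x /Rplus_ge0; exact: geom_Q_le.
have : K%:R * s / (s - A) < n%:R.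
  by apply: lt_le_trans (truncnS_gt _) _; rewrite ler_nat.
rewrite ltr_pdivrMr ?subr_gt0// => Kn.
have c2 : 0 <= c * n%:R ^+ 2 by rewrite mulr_ge0// exprn_ge0.
nra.
Qed.

(** On ]1, oo[, a set of positive mass, the sum S_K is at least K. *)
Lemma Rintegral_geom_unbounded (R : realType)
    (nu : {finite_measure set R -> \bar R}) A :
  compactly_supported nu -> (0 < nu `]1%R, +oo[%classic)%E ->
  exists K, A < \int[nu]_(x in Rplus) (geom R K).[x].
Proof.
move=> cpt; set U : set R := `]1, +oo[%classic.
have mU : measurable U by exact: measurable_itv.
rewrite -(fineK (fin_num_measure nu _ mU)) lte_fin; set p := fine _ => p0.
have sK K : K%:R * p <= \int[nu]_(x in Rplus) (geom R K).[x].
  rewrite -lee_fin fineK; last first.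
    apply: integrable_fin_num; first exact: measurable_Rplus.
    exact: integrable_horner.
  rewrite EFinM fineK ?fin_num_measure// -integral_cst//.
  have mK (D : set R) : measurable_fun D (fun x => ((geom R K).[x])%:E).
    by apply/measurable_EFinP; exact: measurable_poly.
  apply: (@le_trans _ _ (\int[nu]_(x in U) ((geom R K).[x])%:E)%E).
    apply: ge0_le_integral => // x.
      by rewrite lee_fin.
    by rewrite /U/= in_itv/= andbT lee_fin => x1; rewrite geom_ge1// ltW.
  apply: ge0_subset_integral => //; first exact: measurable_Rplus.
    by move=> x /Rplus_ge0 x0; rewrite lee_fin geom_ge0.
  move=> x; rewrite /U/Rplus/= !in_itv/= !andbT => x1.
  by rewrite (le_trans ler01)// ltW.
exists (Num.truncn (A / p)).+1; apply: lt_le_trans (sK _).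
by rewrite -ltr_pdivrMr// truncnS_gt.
Qed.

Lemma slope_eventually_ge_quadratic (R : realType)
    (nu : {measure set R -> \bar R}) c A : 0 < c ->
  exists N, forall n, (N <= n)%N -> A <= slope nu c n.
Proof.
move=> c0; exists (Num.truncn (A / c)).+1 => n Nn.
have n0 : (0 < n)%N by exact: leq_trans Nn.
have : A / c < n%:R by apply: lt_le_trans (truncnS_gt _) _; rewrite ler_nat.
rewrite ltr_pdivrMr// => An; rewrite ler_pdivlMr ?ltr0n//.
have n1 : (0 : R) < n%:R by rewrite ltr0n.
have := Rintegral_Q_ge0 nu n.
nra.
Qed.

(** * Reduction to the unit interval and monotone convergence *)

Lemma itv01P (R : realType) (x : R) : I01 x -> 0 <= x /\ 0 < 1 - x.
Proof. by rewrite /= in_itv/= => /andP[x0 x1]; rewrite subr_gt0. Qed.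

Lemma measurable_geomM (R : realType) (D : set R) (h : R -> R) n :
  measurable_fun D h ->
  measurable_fun D (fun x => (h x * (geom R n).[x])%:E).
Proof.
by move=> mh; apply/measurable_EFinP/measurable_funM => //; exact: measurable_poly.
Qed.

Lemma integral_Rplus_itv01 (R : realType) (nu : {measure set R -> \bar R})
    (f : R -> \bar R) :
  nu [set 1] = 0%E -> nu `]1, +oo[%classic = 0%E -> measurable_fun setT f ->
  (\int[nu]_(x in Rplus) f x = \int[nu]_(x in I01) f x)%E.
Proof.
move=> nu1 nu1y mf.
have RE : @Rplus R = I01 `|` `[1, +oo[%classic.
  apply/seteqP; split=> x; rewrite /Rplus/= !in_itv/= !andbT.
    by move=> x0; have [x1|x1] := ltP x 1; [left; rewrite x0|right].
  by case=> [/andP[]//|]; exact: le_trans.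
have nu1c : nu `[1, +oo[%classic = 0%E.
  by rewrite -(setU1itv false)// measureU0.
rewrite RE integral_setU//.
- by rewrite [X in (_ + X)%E]null_set_integral ?adde0//; exact: measurable_funTS.
- exact: measurable_funTS.
- rewrite disj_set2E; apply/eqP/seteqP; split=> // x [] /=.
  by rewrite !in_itv/= andbT => /andP[_ x1]; rewrite leNgt x1.
Qed.

Lemma cvg_geom (R : realType) (x : R) : I01 x ->
  (geom R n).[x] @[n --> \oo] --> (1 - x)^-1.
Proof.
move=> /itv01P[x0 x1]; have nx : `|x| < 1 by rewrite ger0_norm// -subr_gt0.
have := @cvg_geometric_series _ 1 _ nx; rewrite mul1r; apply: cvg_trans.
apply: near_eq_cvg; near=> n; rewrite horner_geom /series/= big_mkord.
by apply: eq_bigr => i _; rewrite mul1r.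
Unshelve. all: by end_near. Qed.

(** Monotone convergence. The weight is 1 for Gamma_1 and 1 / (1 - x) for
Gamma_2. *)
Lemma cvg_integral_geom (R : realType) (nu : {measure set R -> \bar R})
    (h : R -> R) : measurable_fun setT h ->
  (forall x, I01 x -> 0 <= h x) ->
  (\int[nu]_(x in I01) (h x * (geom R n).[x])%:E @[n --> \oo] -->
   \int[nu]_(x in I01) (h x / (1 - x))%:E)%E.
Proof.
move=> mh h0.
have -> : (\int[nu]_(x in I01) (h x / (1 - x))%:E =
  \int[nu]_(x in I01) (limn (fun n => (h x * (geom R n).[x])%:E)))%E.
  apply: eq_integral => x /set_mem xI; apply/esym/cvg_lim => //.
  by apply: cvg_EFin; [near=> n|apply: cvgMr; exact: cvg_geom].
apply: cvg_monotone_convergence => //.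
- by move=> n; apply: measurable_geomM; exact: measurable_funTS.
- move=> n x xI; have [x0 _] := itv01P xI.
  by rewrite lee_fin mulr_ge0 ?h0 ?geom_ge0.
- move=> x xI m n mn; have [x0 _] := itv01P xI.
  by rewrite lee_fin ler_wpM2l ?h0// geom_nondecreasing.
Unshelve. all: by end_near. Qed.

Lemma integral_geom_gt (R : realType) (nu : {measure set R -> \bar R})
    (h : R -> R) (A : \bar R) : measurable_fun setT h ->
  (forall x, I01 x -> 0 <= h x) ->
  (A < \int[nu]_(x in I01) (h x / (1 - x))%:E)%E ->
  exists n, (A < \int[nu]_(x in I01) (h x * (geom R n).[x])%:E)%E.
Proof.
move=> mh h0 Ah; apply: contrapT => noA; move: Ah; apply/negP; rewrite -leNgt.
have c := @cvg_integral_geom R nu h mh h0.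
rewrite -(cvg_lim _ c)//; apply: lime_le; first by apply/cvg_ex; eexists; exact: c.
by near=> n; rewrite leNgt; apply/negP => An; apply: noA; exists n.
Unshelve. all: by end_near. Qed.

(** * The slopes when Gamma_1 is finite *)

(** The quantity n Gamma_1 - \int Q_n, written as an integral of a nonnegative
function so that it makes sense when Gamma_1 is infinite. *)
Definition deficit (R : realType) (nu : {measure set R -> \bar R}) (n : nat) :
    \bar R :=
  (\int[nu]_(x in I01) ((1 - x)^-1 * (geom R n).[x])%:E)%E.

Lemma EFin_Rintegral_Rplus (R : realType)
    (nu : {finite_measure set R -> \bar R}) (p : {poly R}) :
  compactly_supported nu -> nu [set 1] = 0%E -> nu `]1, +oo[%classic = 0%E ->
  (\int[nu]_(x in Rplus) p.[x])%:E = (\int[nu]_(x in I01) (p.[x])%:E)%E.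
Proof.
move=> cpt nu1 nu1y; rewrite -integral_Rplus_itv01//.
  rewrite fineK//; apply: integrable_fin_num; first exact: measurable_Rplus.
  exact: integrable_horner.
by apply/measurable_EFinP; exact: measurable_poly.
Qed.

Lemma Gamma_itv01 (R : realType) (nu : {measure set R -> \bar R}) j :
  nu [set 1] = 0%E -> nu `]1, +oo[%classic = 0%E ->
  Gamma_ nu j = (\int[nu]_(x in I01) (((1 - x)^-1) ^+ j)%:E)%E.
Proof.
move=> nu1 nu1y; rewrite /Gamma_ integral_Rplus_itv01//.
  by apply: eq_integral => x _; rewrite div1r exprVn.
apply/measurable_EFinP; under eq_fun do rewrite div1r -exprVn.
by apply: measurable_funX; exact: measurable_onemV.
Qed.

Lemma onemV_ge0 (R : realType) (x : R) : I01 x -> 0 <= (1 - x)^-1.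
Proof. by move=> /itv01P[_ ?]; rewrite invr_ge0 ltW. Qed.

Section deficit_Gamma2.
Variables (R : realType) (nu : {measure set R -> \bar R}).
Hypotheses (nu1 : nu [set 1] = 0%E) (nu1y : nu `]1, +oo[%classic = 0%E).

Lemma deficit_ge0 n : (0 <= deficit nu n)%E.
Proof.
apply: integral_ge0 => x xI; have [x0 _] := itv01P xI.
by rewrite lee_fin mulr_ge0 ?onemV_ge0 ?geom_ge0.
Qed.

Lemma deficit0 : deficit nu 0 = 0%E.
Proof.
by apply: integral0_eq => x _; rewrite /geom big_ord0 horner0 mulr0.
Qed.

(** (1 - x) S_n = 1 - x^n, so the deficits fall short of Gamma_2 by a weighted
moment of order n. *)
Lemma Gamma2_deficit n : (Gamma_ nu 2 = deficit nu n +
  \int[nu]_(x in I01) (x ^+ n * (1 - x)^-1 ^+ 2)%:E)%E.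
Proof.
rewrite Gamma_itv01// /deficit -ge0_integralD//; last 4 first.
- by move=> x xI; have [x0 _] := itv01P xI;
    rewrite lee_fin mulr_ge0 ?onemV_ge0 ?geom_ge0.
- by apply: measurable_geomM; exact: measurable_onemV.
- by move=> x xI; have [x0 _] := itv01P xI;
    rewrite lee_fin mulr_ge0 ?exprn_ge0 ?onemV_ge0.
- apply/measurable_EFinP/measurable_funM; first exact: measurable_funX.
  by apply/measurable_funX; exact: measurable_onemV.
apply: eq_integral => x /set_mem /itv01P[x0 x1].
rewrite -EFinD; congr EFin.
have := geomE n x; set s := (geom R n).[x] => sE.
have -> : x ^+ n = 1 - (1 - x) * s by rewrite sE; ring.
by field; rewrite gt_eqF.
Qed.

Lemma deficit_le_Gamma2 n : (deficit nu n <= Gamma_ nu 2)%E.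
Proof.
rewrite (Gamma2_deficit n) leeDl// integral_ge0// => x xI.
by have [x0 _] := itv01P xI; rewrite lee_fin mulr_ge0 ?exprn_ge0 ?onemV_ge0.
Qed.

Lemma deficit_gt1 : (1 < Gamma_ nu 2)%E -> exists n, (1 < deficit nu n)%E.
Proof.
rewrite Gamma_itv01// => A1.
apply: (@integral_geom_gt R nu (fun x => (1 - x)^-1)).
- exact: measurable_onemV.
- exact: onemV_ge0.
- by under eq_integral do rewrite -expr2.
Qed.

End deficit_Gamma2.

Section deficit_slope.
Variables (R : realType) (nu : {finite_measure set R -> \bar R}).
Hypotheses (cpt : compactly_supported nu).
Hypotheses (nu1 : nu [set 1] = 0%E) (nu1y : nu `]1, +oo[%classic = 0%E).

(** The pointwise identity n / (1 - x) = Q_n + S_n / (1 - x), integrated. *)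
Lemma deficitE n : (n%:R%:E * Gamma_ nu 1 =
  (\int[nu]_(x in Rplus) (Q R n).[x])%:E + deficit nu n)%E.
Proof.
rewrite EFin_Rintegral_Rplus// Gamma_itv01// /deficit -ge0_integralD//; last 4 first.
- by move=> x /itv01P[x0 _]; rewrite lee_fin Q_ge0.
- by apply/measurable_EFinP; exact: measurable_poly.
- by move=> x xI; have [x0 _] := itv01P xI;
    rewrite lee_fin mulr_ge0 ?onemV_ge0 ?geom_ge0.
- by apply: measurable_geomM; exact: measurable_onemV.
rewrite -ge0_integralZl//; last 2 first.
- by apply/measurable_EFinP/measurable_funX; exact: measurable_onemV.
- by move=> x xI; rewrite lee_fin exprn_ge0 ?onemV_ge0.
apply: eq_integral => x /set_mem /itv01P[x0 x1].
rewrite -EFinM -EFinD expr1 -(Q_geomE n x) mulrDl mulrAC mulfV ?gt_eqF// mul1r.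
by rewrite [in RHS]mulrC.
Qed.

Lemma slope_deficit g n : Gamma_ nu 1 = g%:E -> (0 < n)%N ->
  deficit nu n = (fine (deficit nu n))%:E /\
  slope nu 0 n = g + (1 - fine (deficit nu n)) / n%:R.
Proof.
move=> g1 n0; have := deficitE n; rewrite g1 -EFinM.
have := deficit_ge0 nu n; case: (deficit nu n) => //= d _.
rewrite -EFinD => -[gE]; split=> //.
rewrite /slope mul0r addr0.
have n0' : n%:R != 0 :> R by rewrite pnatr_eq0 -lt0n.
by rewrite -[g](mulKf n0') [_^-1 * _]mulrC -mulrDl gE; congr (_ / _); ring.
Qed.

Lemma integral_geom_Gamma1 A : (A%:E < Gamma_ nu 1)%E ->
  exists K, A < \int[nu]_(x in Rplus) (geom R K).[x].
Proof.
rewrite Gamma_itv01// => A1.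
have [] := @integral_geom_gt R nu (cst 1) A%:E _ _ _ => //.
  rewrite (_ : (\int[_]_(x in _) _ = \int[nu]_(x in I01) ((1 - x)^-1 ^+ 1)%:E)%E)//.
  by apply: eq_integral => x _; rewrite mul1r.
move=> K AK; exists K; rewrite -lte_fin EFin_Rintegral_Rplus//.
by under eq_integral do rewrite -[X in X%:E]mul1r.
Qed.

End deficit_slope.

(** * Detecting the Dirac measure *)

Lemma deficit_dirac0 (R : realType) (nu : {measure set R -> \bar R}) n :
  is_dirac0 nu -> (0 < n)%N -> deficit nu n = 1%E.
Proof.
case: n => // n nu0 _; rewrite /deficit (@eq_measure_integral _ _ _ _ \d_(0 : R)).
  rewrite integral_dirac//.
    rewrite diracE mem_set ?mul1e /= ?in_itv/= ?lexx ?ltr01//.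
    rewrite subr0 invr1 mul1r horner_geom big_ord_recl expr0 big1 ?addr0//.
    by move=> i _; rewrite exprS mul0r.
  by apply: measurable_geomM; exact: measurable_onemV.
by move=> A mA _; exact: nu0.
Qed.

(** The remainder \int x^n / (1 - x)^2 in Gamma_2 vanishes, and its integrand is
positive on ]0, 1[, so nu is carried by 0. Since 1 / (1 - x)^2 is 1 at 0, the
mass at 0 is Gamma_2. *)
Lemma deficit1_dirac0 (R : realType) (nu : {measure set R -> \bar R}) n :
  on_Rplus nu -> nu [set 1] = 0%E -> nu `]1, +oo[%classic = 0%E ->
  Gamma_ nu 2 = 1%E -> deficit nu n = 1%E -> is_dirac0 nu.
Proof.
move=> nuR nu1 nu1y G2 dn.
have mf (D : set R) k :
    measurable_fun D (fun x : R => (x ^+ k * (1 - x)^-1 ^+ 2)%:E).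
  apply/measurable_EFinP/measurable_funM; first exact: measurable_funX.
  by apply/measurable_funX; exact: measurable_onemV.
have mf2 (D : set R) : measurable_fun D (fun x : R => ((1 - x)^-1 ^+ 2)%:E).
  by apply/measurable_EFinP/measurable_funX; exact: measurable_onemV.
have nuI : nu `]0, 1[%classic = 0%E.
  have f0 (x : R) : I01 x -> (0 <= (x ^+ n * (1 - x)^-1 ^+ 2)%:E)%E.
    by move=> xI; have [x0 _] := itv01P xI;
      rewrite lee_fin mulr_ge0 ?exprn_ge0 ?onemV_ge0.
  have : (\int[nu]_(x in I01) `|(x ^+ n * (1 - x)^-1 ^+ 2)%:E| = 0)%E.
    transitivity (\int[nu]_(x in I01) (x ^+ n * (1 - x)^-1 ^+ 2)%:E)%E.
      by apply: eq_integral => x /set_mem xI; rewrite gee0_abs// f0.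
    have := Gamma2_deficit nu1 nu1y n; rewrite G2 dn.
    have : (0 <= \int[nu]_(x in I01) (x ^+ n * (1 - x)^-1 ^+ 2)%:E)%E.
      exact: integral_ge0.
    case: (integral _ _ _) => //= r r0.
    by rewrite -EFinD => -[r1]; congr EFin; lra.
  move/(ae_eq_integral_abs nu (measurable_itv _) (mf _ _)).1.
  move=> h; apply: measure_negligible => //; apply: negligibleS h => x /=.
  rewrite !in_itv/= => /andP[x0 x1] xn.
  move: xn; rewrite (ltW x0) x1 => /(_ isT)/eqP; apply/negP.
  by rewrite eqe mulf_neq0// expf_neq0// ?invr_neq0 ?gt_eqF ?subr_gt0.
have IE : I01 = [set (0 : R)] `|` `]0, 1[%classic.
  by rewrite (setU1itv false)// bnd_simp ltr01.
have nu00 : nu [set 0] = 1%E.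
  move: G2; rewrite Gamma_itv01// IE integral_setU//.
  - rewrite [X in (_ + X)%E]null_set_integral// ?adde0.
    move=> <-; rewrite -[LHS]mul1e -integral_cst//.
    by apply: eq_integral => x /set_mem ->; rewrite subr0 invr1 expr1n.
  - rewrite disj_set2E; apply/eqP/seteqP; split=> // x [/= ->].
    by rewrite in_itv/= ltxx.
have nuN0 : nu (~` [set 0]) = 0%E.
  have mR : measurable (~` @Rplus R) by apply: measurableC; exact: measurable_Rplus.
  apply: measure_negligible; first exact: measurableC.
  apply: (@negligibleS _ _ _ _
      (~` @Rplus R `|` (`]0, 1[%classic `|` ([set 1] `|` `]1, +oo[%classic)))).
    move=> x /= x0.
    have [xl|xg|/esym//] := ltgtP x 0; first by left=> /Rplus_ge0; rewrite leNgt xl.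
    right; have [x1|x1|->] := ltgtP x 1; [left|right; right|by right; left].
      by rewrite /= in_itv/= xg.
    by rewrite /= in_itv/= x1.
  by do ![apply: negligibleU]; apply/negligibleP.
move=> A mA; rewrite -[in LHS](setIT A) -(setUv [set 0]) setIUr measureU0; last 3 first.
- exact: measurableI.
- by apply: measurableI => //; exact: measurableC.
- apply/eqP; rewrite -measure_le0 -nuN0 le_measure ?inE//.
  + by apply: measurableI => //; exact: measurableC.
  + exact: measurableC.
rewrite /dirac indicE; have [/set_mem A0|A0] := boolP (0 \in A).
  by rewrite (_ : A `&` _ = [set 0])//; apply/seteqP; split=> x /=; [case|move=> ->].
rewrite (_ : A `&` _ = set0) ?measure0//; apply/seteqP; split=> // x [Ax /= x0].
by move: A0; rewrite -x0 mem_set.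
Qed.

(** * The shape of Omega *)

Theorem theorem5p2 (R : realType) (nu : {finite_measure set R -> \bar R})
    (nu_Rplus : on_Rplus nu) (nu_cpt : compactly_supported nu)
    (nu1 : nu [set (1 : R)] = 0%E) (c : R) (c_ge0 : 0 <= c) :
  (* (i) *)
  ([\/ (1 < vartheta nu)%E,
       (vartheta nu <= 1)%E /\ 0 < c
     | [/\ (vartheta nu <= 1)%E, c = 0 & Gamma_ nu 1 = +oo%E]] ->
   Omega nu c = [set t | (frakb nu c < t%:E)%E] /\
   (-oo < frakb nu c < 0)%E) /\
  (* (ii) *)
  ((vartheta nu <= 1)%E -> c = 0 -> (Gamma_ nu 1 < +oo)%E ->
   [/\ (1 < Gamma_ nu 2 <= +oo)%E ->
         Omega nu c = [set t | (frakb nu c < t%:E)%E] /\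
         (- Gamma_ nu 1 < frakb nu c < 0)%E,
       Gamma_ nu 2 = 1%E -> is_dirac0 nu ->
         Omega nu c = [set t | (- Gamma_ nu 1 < t%:E)%E],
       Gamma_ nu 2 = 1%E -> ~ is_dirac0 nu ->
         Omega nu c = [set t | (- Gamma_ nu 1 <= t%:E)%E]
     & (Gamma_ nu 2 < 1)%E ->
         Omega nu c = [set t | (- Gamma_ nu 1 <= t%:E)%E]]).
Proof.
split=> [hyp|th1 c0 G1fin].
  (* m_n is eventually above m_1, indeed above any real number *)
  suff hN : exists N, forall n, (N <= n)%N -> slope nu c 1 <= slope nu c n.
    by have [-> -> _] := Omega_open_ray c_ge0 (isT : (0 < 1)%N) hN.
  case: hyp => [/measure_lt_sup_msupp p0|[th1 c0]|[/measure_gt_sup_msupp nu1y _ G1y]].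
  - suff [K sK] : exists K, slope nu c 1 < \int[nu]_(x in Rplus) (geom R K).[x].
      exact: slope_eventually_ge nu_cpt c_ge0 sK.
    exact: Rintegral_geom_unbounded.
  - exact: slope_eventually_ge_quadratic.
  - have [|K sK] := @integral_geom_Gamma1 R nu nu_cpt nu1 nu1y (slope nu c 1).
      by rewrite G1y ltry.
    exact: slope_eventually_ge nu_cpt c_ge0 sK.
have nu1y := measure_gt_sup_msupp th1.
have [g G1] : exists g, Gamma_ nu 1 = g%:E.
  exists (fine (Gamma_ nu 1)); rewrite fineK// ge0_fin_numE//.
  by rewrite Gamma_itv01// integral_ge0// => x xI; rewrite lee_fin exprn_ge0// onemV_ge0.
pose d n := fine (deficit nu n).
have dE n : (0 < n)%N -> deficit nu n = (d n)%:E.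
  by move=> n0; have [] := slope_deficit nu_cpt nu1 nu1y G1 n0.
have sE n : (0 < n)%N -> slope nu c n = g + (1 - d n) / n%:R.
  by move=> n0; rewrite c0; have [] := slope_deficit nu_cpt nu1 nu1y G1 n0.
(* 0 <= D_n < 1 traps m_n in ]Gamma_1, Gamma_1 + 1/n] *)
have closed : (forall n, (0 < n)%N -> d n < 1) ->
    Omega nu c = [set t | (- Gamma_ nu 1 <= t%:E)%E].
  move=> d1; rewrite (@Omega_closed_ray _ _ _ g).
    by apply/seteqP; split=> t /=; rewrite G1 -EFinN lee_fin.
  move=> n n0; rewrite sE// ltrDl divr_gt0 ?subr_gt0 ?d1 ?ltr0n//= lerD2l.
  rewrite ler_pdivrMr ?ltr0n// mulVf ?pnatr_eq0 -?lt0n// gerBl.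
  by rewrite -lee_fin -dE// deficit_ge0.
split.
- move=> /andP[/(deficit_gt1 nu1 nu1y)[n0 dn0] _].
  have n0_gt0 : (0 < n0)%N.
    by case: n0 dn0 => //; rewrite deficit0 lte_fin ltr10.
  have sg : slope nu c n0 < g.
    rewrite sE// gtrDl pmulr_llt0 ?invr_gt0 ?ltr0n// subr_lt0.
    by rewrite -lte_fin -dE.
  have [|K sK] := @integral_geom_Gamma1 R nu nu_cpt nu1 nu1y (slope nu c n0).
    by rewrite G1 lte_fin.
  have [|-> /andP[_ ->] sb] := @Omega_open_ray R nu c n0 c_ge0 n0_gt0.
    exact: slope_eventually_ge nu_cpt c_ge0 sK.
  split=> //; rewrite andbT; apply: lt_le_trans sb.
  by rewrite G1 -EFinN lte_fin ltrN2.
- move=> _ dir; have sg n : (0 < n)%N -> slope nu c n = g.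
    move=> n0; rewrite sE// /d (deficit_dirac0 dir n0) /= subrr mul0r addr0//.
  apply/seteqP; split=> t /=; rewrite G1 -EFinN lte_fin.
    by move=> /OmegaP /(_ 1%N isT); rewrite sg.
  by move=> gt; apply/OmegaP => n n0; rewrite sg.
- move=> G2 ndir; apply: closed => n n0.
  rewrite lt_neqAle -lee_fin -dE// -G2 deficit_le_Gamma2// andbT.
  apply/eqP => dn; apply: ndir; apply: (@deficit1_dirac0 _ _ n) => //.
  by rewrite dE// dn.
- move=> G2; apply: closed => n n0.
  by rewrite -lte_fin -dE//; apply: le_lt_trans G2; exact: deficit_le_Gamma2.
Qed.
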